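(* Let $\Gamma$ be a set of cyclic loop conditions and let $D\subset\mathbb{N}^+$ be a finite nonempty set. Then the following are equivalent: (1) $\Gamma\Rightarrow\Sigma_D$. (2) There is a finite $\Gamma'\subseteq\Gamma$ such that $\Gamma'\Rightarrow\Sigma_D$. (3) There is a finite $\Gamma'\subseteq\Gamma$ such that for every $c\in\mathbb{N}^+$: if $\operatorname{Pol}(\mathbb{D}\mathbin{\dot{\div}} c)\models\Gamma'$, then $\operatorname{Pol}(\mathbb{D}\mathbin{\dot{\div}} c)\models\Sigma_D$. (4) There are $\Sigma_{C_1},\dots,\Sigma_{C_n}\in\Gamma$ and $k_1,\dots,k_n\in\mathbb{N}^+$ (for some $n\geq0$) such that there is a digraph homomorphism $\mathbb{C}_1^{\bullet k_1}\bullet\cdots\bullet\mathbb{C}_n^{\bullet k_n}\to\mathbb{D}$, where $\mathbb{C}_i$ denotes the disjoint union of cycles associated to the set $C_i$, and the empty product ($n=0$) is the digraph consisting of a single loop.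
   Context: $\mathbb{N}=\{0,1,2,\dots\}$ and $\mathbb{N}^+=\mathbb{N}\setminus\{0\}$. Cycles. A finite disjoint union of cycles is a finite nonempty digraph all of whose connected components are directed cycles (a loop is a directed cycle of length 1). To a finite nonempty $C\subset\mathbb{N}^+$ we associate the digraph $\mathbb{C}$ with vertex set $V_C=\{(a,k)\mid a\in C, k\in\mathbb{Z}_a\}$ and edges $((a,k),(a,k+1))$; $\mathbb{D}$ is the digraph associated to $D$. For $a,c\in\mathbb{N}^+$ put $a\mathbin{\dot{\div}} c=a/\gcd(a,c)$, $D\mathbin{\dot{\div}} c=\{b\mathbin{\dot{\div}} c\mid b\in D\}$, and let $\mathbb{D}\mathbin{\dot{\div}} c$ be the disjoint union of cycles associated to the set $D\mathbin{\dot{\div}} c$. Product $\bullet$. Let $\mathbb{X},\mathbb{Y}$ be finite disjoint unions of cycles; label the vertices of every component of $\mathbb{X}$ of length $a$ by $0,1,\dots,a-1$ along the cycle (for $\mathbb{X}=\mathbb{C}$ associated to a set, vertex $(a,k)$ gets label $k$), and write $u+1$ for the unique out-neighbour of a vertex $u$. $\mathbb{X}\bullet\mathbb{Y}$ has vertex set $\mathbb{X}\times\mathbb{Y}$, and the unique out-neighbour of $(x,y)$ is $(x+1,y+1)$ if $x$ has the last label $a-1$ of its cycle, and $(x+1,y)$ otherwise. Up to isomorphism this does not depend on the labelling, and iterated products do not depend on the bracketing. $\mathbb{X}^{\bullet 0}$ is a single loop and $\mathbb{X}^{\bullet(k+1)}=\mathbb{X}\bullet\mathbb{X}^{\bullet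 k}$. Clones. A clone is a set of operations of arity $\geq1$ on a fixed nonempty set that contains all projections and is closed under composition. For a digraph $\mathbb{G}$, $\operatorname{Pol}(\mathbb{G})$ is the clone of all homomorphisms $\mathbb{G}^n\to\mathbb{G}$, $n\geq1$. Cyclic loop conditions. For a finite nonempty $C\subset\mathbb{N}^+$ let $\sigma_C\colon V_C\to V_C$, $(a,k)\mapsto(a,k+1)$. The cyclic loop condition $\Sigma_C$ is the identity $f\approx f_{\sigma_C}$: a clone $\mathcal{C}$ on a set $A$ satisfies $\Sigma_C$ ($\mathcal{C}\models\Sigma_C$) if there is an operation $f\colon A^{V_C}\to A$ in $\mathcal{C}$ (identify $V_C$ with $\{1,\dots,|V_C|\}$ by any bijection) such that $f(t)=f(t\circ\sigma_C)$ for all $t\in A^{V_C}$. (In general a cyclic loop condition is an identity $f(x_{\sigma(1)},\dots,x_{\sigma(m)})\approx f(x_{\tau(1)},\dots,x_{\tau(m)})$ with $\sigma,\tau\colon[m]\to[n]$ whose digraph $([n],\{(\sigma(i),\tau(i))\mid i\in[m]\})$ is a disjoint union of directed cycles; it is equivalent to, and identified with, $\Sigma_C$ where $C$ is the set of lengths of these cycles.) A clone satisfies a set of cyclic loop conditions if it satisfies each member (different members use different function symbols). $\Gamma\Rightarrow\Sigma$ means that every clone satisfying $\Gamma$ satisfies $\Sigma$. *)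

(* Defs.v *)
From mathcomp Require Import all_boot finmap.
From mathcomp Require Import classical_sets cardinality.

Set Implicit Arguments.
Unset Strict Implicit.
Unset Printing Implicit Defensive.

Local Open Scope nat_scope.
Local Open Scope classical_set_scope.

Record digraph := Digraph {
  vertex :> Type;
  edge : vertex -> vertex -> Prop }.

Definition is_hom (G H : digraph) (h : G -> H) : Prop :=
  forall x y : G, edge x y -> edge (h x) (h y).

Definition digraph_exp (G : digraph) (n : nat) : digraph :=
  @Digraph ('I_n -> G) (fun x y => forall i, edge (x i) (y i)).

Arguments is_hom : clear implicits.

(* Operations are compared by Leibniz equality, which is the pointwise one by
   functional extensionality. *)
Definition op (A : Type) (n : nat) : Type := ('I_n -> A) -> A.

Definition opset (A : Type) : Type := forall n, set (op A n).

Definition is_clone (A : Type) (P : opset A) : Prop :=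
  [/\ inhabited A,
      forall n (f : op A n), P n f -> 0 < n,
      forall n (i : 'I_n), P n (fun x => x i)
    & forall m n (f : op A m) (g : 'I_m -> op A n),
        P m f -> (forall i, P n (g i)) -> P n (fun x => f (fun i => g i x))].

Definition Pol (G : digraph) : opset G :=
  fun n f => 0 < n /\ is_hom (digraph_exp G n) G f.

Arguments Pol : clear implicits.

Lemma Pol_is_clone (G : digraph) : inhabited G -> is_clone (Pol G).
Proof.
move=> G0; split=> //.
- by move=> n f [].
- by move=> n i; split=> [|x y]; [exact: leq_ltn_trans (ltn_ord i) | exact].
- move=> m n f g [m0 hf] hg; split=> [|x y xy].
    by have [] := hg (Ordinal m0).
  by apply: hf => i; have [_] := hg i; exact.
Qed.

(* [order cnext x] is the length of the cycle through [x].  Since every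
   product needs a labelling of its left factor, a disjoint union of cycles
   always comes with a labelling. *)
Record cycles := Cycles {
  cvertex :> finType;
  cnext : cvertex -> cvertex;
  clabel : cvertex -> nat;
  next_inj : injective cnext;
  label_lt : forall x, clabel x < order cnext x;
  label_next : forall x, clabel (cnext x) = (clabel x).+1 %% order cnext x }.

Definition digraph_of_cycles (X : cycles) : digraph :=
  @Digraph X (fun x y => y = cnext x).
Coercion digraph_of_cycles : cycles >-> digraph.

Lemma modSmod m d : (m %% d).+1 %% d = m.+1 %% d.
Proof. by rewrite -addn1 modnDml addn1. Qed.

Lemma order_of_label (T : finType) (f : T -> T) (lab : T -> nat) (x : T) n :
  (forall i, lab (iter i f x) = (lab x + i) %% n) -> iter n f x = x ->
  0 < n -> order f x = n.
Proof.
move=> labE fx n0.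
suff [cT uT] : fcycle f (traject f x n) /\ uniq (traject f x n).
  rewrite (order_cycle cT uT) ?size_traject //.
  by apply/trajectP; exists 0.
split.
  case: n n0 fx {labE} => // n _ fx /=.
  by rewrite rcons_path fpath_traject /= last_traject -iterS fx eqxx.
apply/(uniqP x) => i j; rewrite !inE !size_traject => i_n j_n.
rewrite !nth_traject // => /(congr1 lab).
rewrite !labE => /eqP; rewrite eqn_modDl !modn_small //.
by move/eqP.
Qed.

(* The finite nonempty subsets of the positive integers. *)
Definition is_lengths (C : {fset nat}) : bool := (C != fset0) && (0 \notin C).

Definition V (C : {fset nat}) : finType := {a : C & 'I_(val a)}.

Definition sigma (C : {fset nat}) (u : V C) : V C :=
  Tagged (fun a : C => 'I_(val a)) (ordS (tagged u)).

Definition label_V (C : {fset nat}) (u : V C) : nat := tagged u.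

Section CyclesOf.
Variable C : {fset nat}.
Implicit Type u : V C.

Lemma sigma_inj : injective (@sigma C).
Proof.
move=> [a i] [b j] /eqP; rewrite -tag_eqE /tag_eq /= => /andP[/eqP eab].
subst b; rewrite tagged_asE => /eqP /ordS_inj ij.
by rewrite ij.
Qed.

Lemma iter_sigma u n : tag (iter n (@sigma C) u) = tag u /\
  label_V (iter n (@sigma C) u) = (label_V u + n) %% val (tag u).
Proof.
elim: n => [|n [IHt IHl]] /=.
  by rewrite addn0 modn_small // ltn_ord.
split=> //; rewrite {1}/label_V /= -/(label_V _) IHt IHl.
by rewrite modSmod addnS.
Qed.

Lemma order_sigma u : order (@sigma C) u = val (tag u).
Proof.
have u0 : 0 < val (tag u) by exact: leq_ltn_trans (ltn_ord (tagged u)).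
apply: (@order_of_label _ _ (@label_V C)) => // [i|].
  by case: (iter_sigma u i).
have [] := iter_sigma u (val (tag u)).
rewrite modnDr modn_small ?ltn_ord // /label_V.
case: (iter _ _ _) => b j /=; case: u u0 => a i /= _ eba.
by subst b => /= /val_inj ->.
Qed.

Lemma label_V_lt u : label_V u < order (@sigma C) u.
Proof. by rewrite order_sigma ltn_ord. Qed.

Lemma label_V_next u :
  label_V (sigma u) = (label_V u).+1 %% order (@sigma C) u.
Proof. by rewrite order_sigma. Qed.

Definition cycles_of : cycles := Cycles sigma_inj label_V_lt label_V_next.

End CyclesOf.

Definition dotdiv (D : {fset nat}) (c : nat) : {fset nat} :=
  [fset b %/ gcdn b c | b in D]%fset.

Lemma order_next (X : cycles) (x : X) :
  order (@cnext X) (cnext x) = order (@cnext X) x.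
Proof. exact: order_id_cycle (cycle_orbit (@next_inj X) x). Qed.

Lemma order_iter_next (X : cycles) (x : X) n :
  order (@cnext X) (iter n (@cnext X) x) = order (@cnext X) x.
Proof. by elim: n => //= n IHn; rewrite order_next. Qed.

Lemma label_iter (X : cycles) (x : X) n :
  clabel (iter n (@cnext X) x) = (clabel x + n) %% order (@cnext X) x.
Proof.
elim: n => [|n IHn] /=; first by rewrite addn0 modn_small ?label_lt.
rewrite label_next IHn order_iter_next.
by rewrite modSmod addnS.
Qed.

Section Bullet.
Variables X Y : cycles.
Implicit Type u : X * Y.

Definition bullet_next u : X * Y :=
  (cnext u.1,
   if clabel u.1 == (order (@cnext X) u.1).-1 then cnext u.2 else u.2).

(* The cycles through [x] and [y], of lengths [a] and [b], give rise to a
   single cycle of length [a * b], along which [clabel x + a * clabel y]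
   increases by one. *)
Definition bullet_label u : nat :=
  clabel u.1 + order (@cnext X) u.1 * clabel u.2.

Lemma bullet_next_inj : injective bullet_next.
Proof.
move=> [x y] [x' y'] [/next_inj <-].
by case: ifP => _ => [/next_inj|] ->.
Qed.

Lemma label_lastE (x : X) n :
  (clabel (iter n (@cnext X) x) == (order (@cnext X) x).-1)
    = (order (@cnext X) x %| (clabel x + n).+1).
Proof.
rewrite label_iter; move: (clabel x + n) => m.
have := order_gt0 (@cnext X) x; case: (order _ _) => // a _ /=.
rewrite /dvdn -(addn1 m) -modnDml addn1.
have := ltn_pmod m (ltn0Sn a); rewrite ltnS leq_eqVlt => /orP[/eqP->|lt_ma].
  by rewrite eqxx modnn.
by rewrite [in RHS]modn_small // ltn_eqF.
Qed.

Lemma iter_bullet u n : iter n bullet_next u =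
  (iter n (@cnext X) u.1,
   iter ((clabel u.1 + n) %/ order (@cnext X) u.1) (@cnext Y) u.2).
Proof.
elim: n => [|n IHn]; first by rewrite addn0 divn_small ?label_lt //; case: u.
rewrite iterS IHn /bullet_next /= order_iter_next label_lastE addnS.
by rewrite divnS ?order_gt0 //; case: (_ %| _).
Qed.

Lemma bullet_label_ltM u :
  bullet_label u < order (@cnext X) u.1 * order (@cnext Y) u.2.
Proof.
apply: (@leq_trans (order (@cnext X) u.1 * (clabel u.2).+1)).
  by rewrite /bullet_label mulnS ltn_add2r label_lt.
by rewrite leq_mul2l label_lt orbT.
Qed.

Lemma bullet_label_iter u n : bullet_label (iter n bullet_next u) =
  (bullet_label u + n) %% (order (@cnext X) u.1 * order (@cnext Y) u.2).
Proof.
rewrite iter_bullet /bullet_label /= !label_iter order_iter_next.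
set a := order _ u.1; set b := order _ u.2.
have a0 : 0 < a by exact: order_gt0.
have -> : clabel u.1 + a * clabel u.2 + n =
    a * (clabel u.2 + (clabel u.1 + n) %/ a) + (clabel u.1 + n) %% a.
  rewrite addnAC {1}(divn_eq (clabel u.1 + n) a) mulnDr [a * (_ %/ _)]mulnC.
  by rewrite addnC addnA.
set r := (_ + n) %% a; set q := clabel u.2 + _.
rewrite [in RHS](divn_eq q b) mulnDr [a * (_ * b)]mulnCA -addnA modnMDl.
rewrite [RHS]modn_small 1?addnC //.
apply: (@leq_trans (a * (q %% b).+1)).
  by rewrite mulnS ltn_add2r ltn_pmod.
by rewrite leq_mul2l ltn_pmod ?orbT ?order_gt0.
Qed.

Lemma order_bullet u :
  order bullet_next u = order (@cnext X) u.1 * order (@cnext Y) u.2.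
Proof.
apply: (@order_of_label _ _ bullet_label).
- exact: bullet_label_iter.
- rewrite iter_bullet mulnC divnDMl ?order_gt0 // divn_small ?label_lt //.
  rewrite add0n iterM !iter_order; do ?exact: next_inj.
  have -> n : iter n (iter (order (@cnext X) u.1) (@cnext X)) u.1 = u.1.
    by elim: n => //= n ->; rewrite iter_order //; exact: next_inj.
  by case: u.
- by rewrite muln_gt0 !order_gt0.
Qed.

Lemma bullet_label_lt u : bullet_label u < order bullet_next u.
Proof. by rewrite order_bullet bullet_label_ltM. Qed.

Lemma bullet_label_next u :
  bullet_label (bullet_next u) = (bullet_label u).+1 %% order bullet_next u.
Proof. by rewrite order_bullet -addn1 -bullet_label_iter. Qed.

Definition bullet : cycles :=
  Cycles bullet_next_inj bullet_label_lt bullet_label_next.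

End Bullet.

Lemma loop_label_lt (x : unit) : 0 < order id x.
Proof. by rewrite order_id. Qed.

Lemma loop_label_next (x : unit) : 0 = 1 %% order id x.
Proof. by rewrite order_id. Qed.

(* [bullet X loop] is isomorphic to [X], so that [loop] can be used as the
   unit of iterated products. *)
Definition loop : cycles :=
  @Cycles unit id (fun=> 0) (fun _ _ => id) loop_label_lt loop_label_next.

Definition bullet_exp (X : cycles) (k : nat) : cycles := iter k (bullet X) loop.

(* The condition [Sigma_C] is represented by the set [C], and a set of cyclic
   loop conditions by a set of such [C].  [enum_val] identifies [V C] with ['I_#|V C|]. *)
Definition satisfies (A : Type) (P : opset A) (C : {fset nat}) : Prop :=
  exists2 f : op A #|V C|, P _ f &
    forall t : V C -> A,
      f (t \o enum_val) = f ((t \o @sigma C) \o enum_val).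

Definition satisfies_all (A : Type) (P : opset A) (G : set {fset nat}) : Prop :=
  forall C, G C -> satisfies P C.

Definition entails (G : set {fset nat}) (D : {fset nat}) : Prop :=
  forall (A : Type) (P : opset A),
    is_clone P -> satisfies_all P G -> satisfies P D.

(* Main.v *)
Require Import Defs.
From mathcomp Require Import all_boot finmap.
From mathcomp Require Import boolp classical_sets cardinality.

(** A digraph homomorphism between disjoint unions of cycles exists iff every
    cycle length of the source is a multiple of one of the target, and the
    cycle lengths of a product are the products of the cycle lengths.

    (4) => (2): composing the operations for [X] and [Y] gives one for
    [X • Y], and the condition of [X] implies that of [Y] along a
    homomorphism [X -> Y].

    (3) => (4): take all [C] in [Gamma'], each with a large exponent.  For a
    cycle of length [N] of the product, by pigeonhole each [C] contains an [a]
    a high power of which divides [N], so that [a] is coprime to all elements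
    of [D ÷ N]; then the clone [Pol (D ÷ N)] satisfies the condition of [C],
    hence that of [D].  As [D] maps to [D ÷ N], the latter has a loop, i.e.
    some element of [D] divides [N].

    (1) => (3): [D ÷ c] only depends on [gcd (prod D, c)], so finitely many
    failing conditions suffice for all [c].  This gives the compactness
    (1) => (2), via (4). *)

Set Implicit Arguments.
Unset Strict Implicit.
Unset Printing Implicit Defensive.

Local Open Scope nat_scope.
Local Open Scope classical_set_scope.

(** * Iteration along cycles, and homomorphisms between unions of cycles *)

Lemma coprime_modMl a d n m :
  coprime d a -> a * n = a * m %[mod d] -> n = m %[mod d].
Proof.
wlog mn : n m / m <= n => [th co e|co /eqP].
  by case/orP: (leq_total m n) => /th; [apply | move=> ->].
rewrite eqn_mod_dvd ?leq_mul2l ?mn ?orbT // -mulnBr Gauss_dvdr //.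
by rewrite -eqn_mod_dvd // => /eqP.
Qed.

Section Cycles.
Variable X : cycles.
Implicit Type x : X.

Lemma iter_cnext_mod n m x :
  order (@cnext X) x %| m -> iter (n %% m) (@cnext X) x = iter n (@cnext X) x.
Proof.
move=> /dvdnP[q ->]; rewrite [in RHS](divn_eq n (q * order (@cnext X) x)).
rewrite addnC iterD mulnA iterM; congr (iter _ _ _).
by elim: (_ * q) => //= k <-; rewrite iter_order //; exact: next_inj.
Qed.

Lemma iter_cnext_congr n m x : n = m %[mod order (@cnext X) x] ->
  iter n (@cnext X) x = iter m (@cnext X) x.
Proof.
by move=> nm; rewrite -(@iter_cnext_mod n _ x (dvdnn _)) nm iter_cnext_mod.
Qed.

Lemma iter_cnext_id m x :
  order (@cnext X) x %| m -> iter m (@cnext X) x = x.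
Proof. by move=> /eqP m0; rewrite (@iter_cnext_congr m 0) ?m0 ?mod0n. Qed.

Lemma iter_cnext_eq n m x : iter n (@cnext X) x = iter m (@cnext X) x ->
  n = m %[mod order (@cnext X) x].
Proof.
move=> /(congr1 (@clabel X)); rewrite !label_iter => /eqP.
by rewrite eqn_modDl => /eqP.
Qed.

Lemma order_fixpoint x : cnext x = x -> order (@cnext X) x = 1.
Proof.
by move=> fx; rewrite (@order_cycle _ _ [:: x]) ?inE //= fx eqxx.
Qed.

(** The successor form keeps the period positive: [N] further steps undo one. *)
Lemma exists_period : exists N, forall x, iter N.+1 (@cnext X) x = x.
Proof.
exists ((#|X|)`!).-1 => x; rewrite prednK ?fact_gt0 // iter_cnext_id //.
by rewrite dvdn_fact // order_gt0 max_card.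
Qed.

End Cycles.

Lemma hom_cycles (X Y : cycles) :
  (forall x : X, exists y : Y, order (@cnext Y) y %| order (@cnext X) x) ->
  exists h, is_hom X Y h.
Proof.
move=> XY.
(* The base point depends on [order x] only, hence is constant on cycles. *)
have /choice[p pP] : forall n, exists o : option Y, forall x : X,
    order (@cnext X) x = n ->
    if o is Some y then order (@cnext Y) y %| n : Prop else False.
  move=> n; have [[x xn]|nx] := pselect (exists x : X, order (@cnext X) x = n).
    by have [y yx] := XY x; exists (Some y) => z _; rewrite -xn.
  (* [Y] may be empty, so a length that does not occur in [X] has no default base point. *)
  by exists None => x xn; apply: nx; exists x.
have /choice[q qP] : forall x : X, exists y, p (order (@cnext X) x) = Some y.
  by move=> x; have := pP _ x erefl; case: (p _) => // y; exists y.
exists (fun x => iter (clabel x) (@cnext Y) (q x)) => x _ ->.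
have -> : q (cnext x) = q x.
  by apply: Some_inj; rewrite -!qP order_next.
(* The label wraps around modulo the source length, which is a multiple of the target length. *)
rewrite label_next /= iter_cnext_mod //.
by have := pP _ x erefl; rewrite qP.
Qed.

Lemma order_cycles_of (C : {fset nat}) (u : cycles_of C) :
  order (@cnext (cycles_of C)) u \in C.
Proof. by rewrite [order _ _]order_sigma; exact: valP. Qed.

Lemma exists_order_cycles_of (C : {fset nat}) a : a \in C -> 0 < a ->
  exists u : cycles_of C, order (@cnext (cycles_of C)) u = a.
Proof.
move=> aC a0.
exists (@existT C (fun b : C => 'I_(val b)) [` aC]%fset (Ordinal a0) : V C).
by rewrite [order _ _]order_sigma.
Qed.

(** * Cyclic conditions of arbitrary unions of cycles in a clone *)

Section Clones.
Variables (A : Type) (P : opset A).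

(** Arguments are indexed by vertices, so that products and homomorphisms act on them directly. *)
Definition admits (X : cycles) : Prop :=
  exists2 F : (X -> A) -> A,
    P (fun s : 'I_#|X| -> A => F (s \o enum_rank)) &
    forall t, F (t \o @cnext X) = F t.

Lemma satisfiesP C : satisfies P C <-> admits (cycles_of C).
Proof.
split=> [[f Pf fP]|[F PF FP]].
  exists (fun t => f (t \o enum_val)); last by move=> t; rewrite (fP t).
  rewrite (_ : (fun s => _) = f) //; apply/funext => s; congr (f _).
  by apply/funext => i /=; rewrite enum_valK.
exists (fun s : 'I_#|V C| -> A => F (s \o enum_rank)) => // t.
have rK (s : V C -> A) : (s \o enum_val) \o enum_rank = s.
  by apply/funext => x /=; rewrite enum_rankK.
by rewrite !rK FP.
Qed.

Hypothesis cP : is_clone P.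

Lemma clone_comp (X : finType) (F : (X -> A) -> A) n (G : X -> op A n) :
  P (fun s : 'I_#|X| -> A => F (s \o enum_rank)) ->
  (forall x, P (G x)) -> P (fun s : 'I_n -> A => F (fun x => G x s)).
Proof.
case: cP => _ _ _ Pcomp PF PG.
have := Pcomp _ _ _ (fun i => G (enum_val i)) PF (fun i => PG _).
congr P; apply/funext => s; congr F.
by apply/funext => x /=; rewrite enum_rankK.
Qed.

Lemma clone_proj n (i : 'I_n) : P (fun s : 'I_n -> A => s i).
Proof. by case: cP. Qed.

Lemma admits_loop : admits loop.
Proof. by exists (fun t => t tt) => //; exact: clone_proj. Qed.

(** Nest [G] inside [F]: invariance of [G] absorbs the shift of [y] at last labels, then invariance
    of [F] absorbs the shift of [x]. *)
Lemma admits_bullet (X Y : cycles) :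
  admits X -> admits Y -> admits (bullet X Y).
Proof.
move=> [F PF FP] [G PG GP].
exists (fun t => F (fun x => G (fun y => t (x, y)))).
  by do 2![apply: clone_comp => // ?]; exact: clone_proj.
move=> t /=; rewrite -[RHS]FP; congr F; apply/funext => x /=.
rewrite /bullet_next /=; case: (_ == _) => //.
by rewrite -[RHS]GP.
Qed.

Lemma admits_bullet_exp (X : cycles) k : admits X -> admits (bullet_exp X k).
Proof.
by move=> PX; elim: k => [|k IHk]; [exact: admits_loop | exact: admits_bullet].
Qed.

Lemma admits_hom (X Y : cycles) h : is_hom X Y h -> admits X -> admits Y.
Proof.
move=> hP [F PF FP]; exists (fun t => F (t \o h)).
  by apply: clone_comp => // x; exact: clone_proj.
move=> t /=; rewrite -[RHS]FP; congr F; apply/funext => x /=.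
by rewrite (hP x _ erefl).
Qed.

End Clones.

(** * Polymorphisms of unions of cycles *)

(** As a tuple, [h] has [h \o cnext] as out-neighbour, and [F] takes the same value on both. *)
Lemma pol_admits_loop (X Y : cycles) h : is_hom X Y h ->
  admits (Pol Y) X -> exists y : Y, cnext y = y.
Proof.
move=> hP [F [_ homF] FP]; exists (F h).
transitivity (F (h \o @cnext X)); last exact: FP.
have := homF (h \o enum_val) (h \o @cnext X \o enum_val).
have rK (s : X -> Y) : (s \o enum_val) \o enum_rank = s.
  by apply/funext => x /=; rewrite enum_rankK.
by rewrite !rK => -> // i; exact: hP.
Qed.

(* On [X -> Y], postcomposition with [cnext] and precomposition with [cnext]
   commute.  Choose a representative [r] in each joint orbit and map
   [cnext^n \o r \o cnext^k] to [cnext^n (r x0)]; this is well defined since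
   [cnext^n \o r \o cnext^k = cnext^m \o r \o cnext^l] implies, by iterating
   [a] times and evaluating at [x0], that [a n = a m] modulo the order of
   [r x0], where [a] is the order of [x0]. *)
Lemma pol_admits_coprime (X Y : cycles) (x0 : X) (y0 : Y) :
  (forall y : Y, coprime (order (@cnext Y) y) (order (@cnext X) x0)) ->
  admits (Pol Y) X.
Proof.
move=> co.
pose act n k (t : X -> Y) : X -> Y :=
  fun x => iter n (@cnext Y) (t (iter k (@cnext X) x)).
have actD n k m l t : act n k (act m l t) = act (n + m) (l + k) t.
  by apply/funext => x; rewrite /act !iterD.
have [NX NXP] := exists_period X; have [NY NYP] := exists_period Y.
have act_period n k t : act (n * NY.+1) (k * NX.+1) t = t.
  apply/funext => x; rewrite /act.
  have iter_id (T : Type) (f : T -> T) z q p :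
      (forall z, iter p f z = z) -> iter (q * p) f z = z.
    by move=> fid; rewrite iterM; elim: q => //= q ->.
  by rewrite !iter_id.
have well n m k l t : act n k t = act m l t ->
    iter n (@cnext Y) (t x0) = iter m (@cnext Y) (t x0).
  move=> nm.
  have nmj j : act (j * n) (j * k) t = act (j * m) (j * l) t.
    elim: j => // j IHj; rewrite !mulSn [k + _]addnC [l + _]addnC.
    rewrite -actD IHj actD addnC [_ + k]addnC -actD nm actD.
    by rewrite addnC [l + _]addnC.
  have := congr1 (fun s => s x0) (nmj (order (@cnext X) x0)).
  rewrite /act !(iter_cnext_id (dvdn_mulr _ (dvdnn _))) => /iter_cnext_eq.
  by move/(coprime_modMl (co (t x0)))/iter_cnext_congr.
pose orbit t := [set s | exists n k, t = act n k s].
have orbit_act n k t : orbit (act n k t) = orbit t.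
  apply/funext => s; apply/propext; split=> [[m [l e]]|[m [l ->]]].
    (* [act (n * NY) (k * NX)] inverts [act n k]. *)
    exists (n * NY + m), (l + k * NX); rewrite -actD -e actD.
    by rewrite addnC -mulnS -mulnS act_period.
  by exists (n + m), (l + k); rewrite actD.
pose rep t := xget (fun=> y0) (orbit t).
have /choice[N NP] : forall t, exists n, exists k, t = act n k (rep t).
  (* The default of [xget] is never taken, since [t] lies in its own orbit. *)
  move=> t; apply: (@xgetPex _ (fun=> y0) (orbit t)).
  by exists t, 0, 0.
pose F t := iter (N t) (@cnext Y) (rep t x0).
(* The case [(1, 0)] makes [F] a polymorphism, the case [(0, 1)] makes it cyclic. *)
have FP n k t : F (act n k t) = iter n (@cnext Y) (F t).
  have repE : rep (act n k t) = rep t by rewrite /rep orbit_act.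
  have [l el] := NP (act n k t); have [m em] := NP t.
  rewrite repE in el; rewrite /F repE -iterD; apply/esym/(well _ _ (m + k) l).
  by rewrite -actD -em.
exists F; last exact: (FP 0 1).
split=> [|s s' ss' /=].
  by rewrite (leq_trans _ (max_card (pred1 x0))) // card1.
apply: etrans (FP 1 0 _); congr F.
by apply/funext => x; exact: ss'.
Qed.

(** * Divisibility of the cycle lengths of products *)

Lemma order_big_bullet (I : eqType) (r : seq I) (X : I -> cycles) i
    (x : (\big[bullet/loop]_(j <- r) X j : cycles)) :
  i \in r -> exists y : X i, order (@cnext (X i)) y %| order (@cnext _) x.
Proof.
elim: r x => // j r IHr; rewrite big_cons => x.
rewrite [order _ x]order_bullet inE => /predU1P[->|/IHr].
  by exists x.1; exact: dvdn_mulr.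
by move=> /(_ x.2)[y yx]; exists y; exact: dvdn_mull.
Qed.

Lemma order_bullet_exp (X : cycles) k (x : bullet_exp X k) :
  exists2 s : seq X, size s = k &
    order (@cnext _) x = \prod_(y <- s) order (@cnext X) y.
Proof.
elim: k x => [x|k IHk x].
  by exists [::]; rewrite // big_nil [LHS]order_id.
have [s sk xs] := IHk x.2; exists (x.1 :: s); rewrite /= ?sk //.
by rewrite big_cons [LHS]order_bullet xs.
Qed.

Lemma pigeonhole_count (T : finType) (s : seq T) m :
  m * #|T| < size s -> exists x, m <= count_mem x s.
Proof.
move=> ms; apply/existsP; apply: contraLR ms => /existsPn sm.
have -> : size s = \sum_x count_mem x s.
  elim: s {sm} => [|y s /= ->]; first by rewrite big1.
  rewrite big_split /= -add1n; congr (_ + _).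
  by rewrite (bigD1 y) //= eqxx big1 // => x; rewrite eq_sym => /negPf ->.
rewrite -leqNgt mulnC -sum_nat_const leq_sum // => x _.
by have := sm x; rewrite -ltnNge => /ltnW.
Qed.

Lemma bullet_exp_high_power (X : cycles) m (x : bullet_exp X (m * #|X|).+1) :
  exists y : X, order (@cnext X) y ^ m %| order (@cnext _) x.
Proof.
have [s sk ->] := order_bullet_exp x.
have [|y my] := @pigeonhole_count X s m; first by rewrite sk.
exists y; apply: dvdn_trans (dvdn_exp2l _ my) _.
rewrite (bigID (pred1 y)) /= dvdn_mulr //.
rewrite (eq_bigr (fun=> order (@cnext X) y)) => [|z /eqP-> //].
by rewrite big_const_seq iter_muln_1.
Qed.

(** For a prime [p] dividing [a], [logn p d < d <= L], so the whole [p]-part of [d] divides [N] and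
    cancels in the quotient. *)
Lemma coprime_divn_gcdn L d N a : 0 < L -> 0 < N -> d %| L -> a ^ L %| N ->
  coprime (d %/ gcdn d N) a.
Proof.
move=> L0 N0 dL aN.
have d0 : 0 < d by exact: dvdn_gt0 dL.
have [a0|a0] := posnP a; first by move: aN; rewrite a0 exp0n // dvd0n gtn_eqF.
rewrite coprime_has_primes ?divn_gt0 ?gcdn_gt0 ?d0 //; last first.
  by rewrite dvdn_leq // dvdn_gcdl.
apply/hasPn => p; rewrite !mem_primes => /and3P[pp _ pa].
apply/negP => /and3P[_ _].
have g0 : 0 < gcdn d N by rewrite gcdn_gt0 d0.
have dp : p ^ logn p d %| gcdn d N.
  rewrite dvdn_gcd pfactor_dvdnn /=; apply: dvdn_trans aN.
  apply: dvdn_trans (dvdn_exp2r _ pa); apply: dvdn_exp2l.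
  by apply: leq_trans (dvdn_leq L0 dL); exact: ltnW (ltn_logl _ d0).
have dq : 0 < d %/ gcdn d N by rewrite divn_gt0 // dvdn_leq // dvdn_gcdl.
rewrite -(expn1 p) pfactor_dvdn // logn_div ?dvdn_gcdl // subn_gt0 ltnNge.
by rewrite -pfactor_dvdn // dp.
Qed.

Lemma mem_dotdiv (D : {fset nat}) c d : d \in D -> d %/ gcdn d c \in dotdiv D c.
Proof. by move=> dD; apply/imfsetP; exists d. Qed.

Lemma dotdiv_gcdn (D : {fset nat}) L c : (forall d, d \in D -> d %| L) ->
  dotdiv D (gcdn L c) = dotdiv D c.
Proof.
move=> DL; apply: eq_in_imfset => // d dD /=.
by rewrite gcdnA (gcdn_idPl (DL d dD)).
Qed.

(** * Testing on the digraphs [dotdiv D c] *)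

Section Reduction.
Variables (Gamma : set {fset nat}) (D : {fset nat}).
Hypothesis D_lengths : is_lengths D.

(** Serves both as a common multiple of [D] and as an exponent above all prime multiplicities in its
    elements. *)
Let L := \prod_(d <- D) d.

Let dvd_L d : d \in D -> d %| L.
Proof. by move=> dD; rewrite /L (big_rem d) //= dvdn_mulr. Qed.

Let D_gt0 d : d \in D -> 0 < d.
Proof.
by case/andP: D_lengths => _ D0 dD; rewrite lt0n; apply: contraNneq D0 => <-.
Qed.

Let L_gt0 : 0 < L.
Proof.
rewrite /L big_seq_cond; apply: prodn_cond_gt0 => d.
by rewrite andbT; exact: D_gt0.
Qed.

Let dotdiv_gt0 c e : 0 < c -> e \in dotdiv D c -> 0 < e.
Proof.
move=> c0 /imfsetP[d /= /D_gt0 d0 ->].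
by rewrite divn_gt0 ?gcdn_gt0 ?d0 // dvdn_leq // dvdn_gcdl.
Qed.

Let dotdiv_inhabited c : 0 < c -> inhabited (cycles_of (dotdiv D c)).
Proof.
move=> c0; case/andP: D_lengths => /fset0Pn[d dD] _.
have eD := mem_dotdiv c dD.
by have [u _] := exists_order_cycles_of eD (dotdiv_gt0 c0 eD).
Qed.

Definition reduces_to (Gamma' : set {fset nat}) : Prop :=
  forall c : nat, 0 < c ->
    satisfies_all (Pol (cycles_of (dotdiv D c))) Gamma' ->
    satisfies (Pol (cycles_of (dotdiv D c))) D.

Lemma entails_reduces_to Gamma' : entails Gamma' D -> reduces_to Gamma'.
Proof.
by move=> GD c c0; apply: GD; apply: Pol_is_clone; exact: dotdiv_inhabited.
Qed.

Lemma reduces_to_finite : reduces_to Gamma ->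
  exists Gamma', [/\ finite_set Gamma', Gamma' `<=` Gamma & reduces_to Gamma'].
Proof.
move=> GD.
pose bad c C := Gamma C /\ ~ satisfies (Pol (cycles_of (dotdiv D c))) C.
have /choice[F FP] : forall c, exists C, (exists C', bad c C') -> bad c C.
  move=> c; have [[C' bC']|nb] := pselect (exists C', bad c C').
    by exists C'.
  by exists fset0.
(* Every [gcdn L c] is at most [L]. The intersection drops values of [F] outside [Gamma], which
   occur only where no condition fails. *)
exists (Gamma `&` F @` `I_L.+1); split; last 1 first.
- move=> c c0 allc; rewrite -(dotdiv_gcdn c dvd_L) in allc *.
  set g := gcdn L c in allc *.
  have g0 : 0 < g by rewrite gcdn_gt0 L_gt0.
  apply: GD => // C GC; apply: contrapT => nC.
  have [GF nF] := FP g (ex_intro _ C (conj GC nC)).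
  apply/nF/allc; split=> //; exists g => //=.
  by rewrite ltnS dvdn_leq // dvdn_gcdl.
- by apply: finite_setIr; apply: finite_image; exact: finite_II.
- by move=> C [].
Qed.

Lemma pol_dotdiv_satisfies C (X := cycles_of C) (u : X) c : 0 < c ->
  order (@cnext X) u ^ L %| c -> satisfies (Pol (cycles_of (dotdiv D c))) C.
Proof.
move=> c0 uc; apply/satisfiesP.
have [y0] := dotdiv_inhabited c0.
apply: (pol_admits_coprime (x0 := u)) => // y.
have /imfsetP[d /= dD ->] := order_cycles_of y.
exact: (coprime_divn_gcdn L_gt0 c0 (dvd_L dD) uc).
Qed.

Lemma pol_dotdiv_dvd c : 0 < c ->
  satisfies (Pol (cycles_of (dotdiv D c))) D -> exists2 d, d \in D & d %| c.
Proof.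
move=> c0 /satisfiesP polD.
have [|h hP] := @hom_cycles (cycles_of D) (cycles_of (dotdiv D c)).
  move=> u; have uE := mem_dotdiv c (order_cycles_of u).
  have [v ve] := exists_order_cycles_of uE (dotdiv_gt0 c0 uE).
  by exists v; rewrite ve dvdn_div ?dvdn_gcdl.
have [v fixv] := pol_admits_loop hP polD.
have := order_cycles_of v; rewrite (order_fixpoint fixv).
move=> /imfsetP[d /= dD d1].
exists d => //; apply/gcdn_idPl.
by rewrite -[RHS](divnK (dvdn_gcdl d c)) -d1 mul1n.
Qed.

Lemma reduces_to_hom (s : seq {fset nat}) : reduces_to [set` s] ->
  exists k : {fset nat} -> nat, (forall C, 0 < k C) /\
    exists h, is_hom
      (\big[bullet/loop]_(i < size s)
         bullet_exp (cycles_of (tnth (in_tuple s) i)) (k (tnth (in_tuple s) i)))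
      (cycles_of D) h.
Proof.
(* The exponent at which the pigeonhole yields an [L]-th power. *)
move=> GD; exists (fun C => (L * #|cycles_of C|).+1); split=> //.
apply: hom_cycles => x; set N := order _ x.
have N0 : 0 < N by exact: order_gt0.
(* The hypothesis is used with [c] equal to the cycle length [N] itself. *)
have [|d dD dN] := pol_dotdiv_dvd N0.
  apply: GD => // C /= /(@tnthP _ _ (in_tuple s) C)[i Ci].
  have [z zN] := order_big_bullet x (mem_index_enum i).
  have [u uz] := bullet_exp_high_power z.
  rewrite Ci; apply: (@pol_dotdiv_satisfies _ u) => //.
  exact: dvdn_trans uz zN.
by have [u ud] := exists_order_cycles_of dD (D_gt0 dD); exists u; rewrite ud.
Qed.

End Reduction.

(** * From homomorphisms back to entailment, and the equivalence *)

Lemma hom_entails (I : Type) (r : seq I) (C : I -> {fset nat}) (k : I -> nat)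
    (D : {fset nat}) h :
  is_hom (\big[bullet/loop]_(i <- r) bullet_exp (cycles_of (C i)) (k i))
    (cycles_of D) h ->
  entails (range C) D.
Proof.
move=> hP A P cP PC; apply/satisfiesP/(admits_hom cP hP).
elim: r {h hP} => [|i r IHr]; first by rewrite big_nil; exact: admits_loop.
rewrite big_cons; apply: admits_bullet => //.
by apply: admits_bullet_exp => //; apply/satisfiesP/PC; exists i.
Qed.

Theorem corollary5p15 (Gamma : set {fset nat}) (D : {fset nat})
    (Gamma_lengths : forall C, Gamma C -> is_lengths C)
    (D_lengths : is_lengths D) :
  [<-> entails Gamma D;
       exists Gamma' : set {fset nat},
         [/\ finite_set Gamma', Gamma' `<=` Gamma & entails Gamma' D];
       exists Gamma' : set {fset nat},
         [/\ finite_set Gamma', Gamma' `<=` Gamma &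
             forall c : nat, 0 < c ->
               satisfies_all (Pol (cycles_of (dotdiv D c))) Gamma' ->
               satisfies (Pol (cycles_of (dotdiv D c))) D];
       exists (n : nat) (C : 'I_n -> {fset nat}) (k : 'I_n -> nat),
         [/\ forall i, Gamma (C i),
             forall i, 0 < k i &
             exists h, is_hom
               (\big[bullet/loop]_(i < n) bullet_exp (cycles_of (C i)) (k i))
               (cycles_of D) h]].
Proof.
(* Stated apart because (1) => (2) also passes through (4), whose factors give the finite set
   [range C]. *)
have step34 Gamma' : finite_set Gamma' -> Gamma' `<=` Gamma ->
    reduces_to D Gamma' ->
    exists (n : nat) (C : 'I_n -> {fset nat}) (k : 'I_n -> nat),
      [/\ forall i, Gamma (C i), forall i, 0 < k i &
          exists h, is_hom
            (\big[bullet/loop]_(i < n) bullet_exp (cycles_of (C i)) (k i))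
            (cycles_of D) h].
  move=> /finite_seqP[s ->] sG /(reduces_to_hom D_lengths)[k [k0 hP]].
  exists (size s), (tnth (in_tuple s)), (fun i => k (tnth (in_tuple s) i)).
  by split=> // i; apply: sG; exact: mem_tnth.
tfae.
- move=> /(entails_reduces_to D_lengths)/(reduces_to_finite D_lengths).
  move=> [Gamma1 [fin1 sub1 /(step34 _ fin1 sub1)]].
  move=> [n [C [k [GC _ [h /hom_entails CD]]]]].
  exists (range C); split=> // [|_ [i _ <-] //].
  by apply: finite_image; exact: finite_finset.
- move=> [Gamma1 [fin1 sub1 ent1]]; exists Gamma1; split=> //.
  exact: entails_reduces_to.
- by move=> [Gamma1 [fin1 sub1 red1]]; exact: step34 red1.
- move=> [n [C [k [GC _ [h /hom_entails CD]]]]] A P cP PG.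
  by apply: CD => // _ [i _ <-]; exact/PG/GC.
Qed.
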